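(* Let $\mathcal{GO}=\langle t,\prec,\phi\rangle$ be a GOMT problem with $\phi$ satisfiable, and let $A_t=\{t^{\mathcal{I}}\mid \mathcal{I}\text{ is }\mathcal{GO}\text{-consistent}\}$. If $\prec$ is well-founded over $A_t$ and $\mathcal{GO}$ has one or more optimal solutions, then every $\mathcal{GO}$-derivation generated by a progressive derivation strategy ends with a saturated state whose interpretation component is an optimal solution of $\mathcal{GO}$.
   Context: Fix a many-sorted first-order theory $\mathcal{T}$ (a signature $\Sigma$ together with a class of $\Sigma$-interpretations, the $\mathcal{T}$-interpretations) with equality, and an infinite set of sorted variables; all interpretations considered are $\mathcal{T}$-interpretations assigning a value to every variable, and $\models$ means $\models_{\mathcal{T}}$. A GOMT problem is a triple $\mathcal{GO}=\langle t,\prec,\phi\rangle$ where $t$ is a $\Sigma$-term of some sort $\sigma$, $\prec$ is a strict partial order on the values of sort $\sigma$ definable in $\mathcal{T}$, and $\phi$ is a $\Sigma$-formula. $\mathcal{I}$ is $\mathcal{GO}$-consistent if $\mathcal{I}\models\phi$; $\mathcal{I}<_{\mathcal{GO}}\mathcal{I}'$ if both are $\mathcal{GO}$-consistent and $t^{\mathcal{I}}\prec t^{\mathcal{I}'}$; $\mathcal{I}$ is an optimal solution if it is $\mathcal{GO}$-consistent and no interpretation $\mathcal{J}$ satisfies $\mathcal{J}<_{\mathcal{GO}}\mathcal{I}$. $\textsc{Solve}$ maps a formula to an interpretation satisfying it if it is satisfiable, and to $\bot$ otherwise. $\textsc{Better}$ maps each $\mathcal{GO}$-consistent $\mathcal{I}$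 to a formula such that for every $\mathcal{GO}$-consistent $\mathcal{I}'$: $\mathcal{I}'\models\textsc{Better}(\mathcal{I})$ iff $\mathcal{I}'<_{\mathcal{GO}}\mathcal{I}$. For a finite sequence $S=(s_1,\dots,s_n)$, $\textsc{Top}(S)=s_1$, $\textsc{Pop}(S)=(s_2,\dots,s_n)$, $\emptyset$ is the empty sequence, $\circ$ is concatenation. A state is $\langle\mathcal{I},\Delta,\tau\rangle$ ($\mathcal{I}$ an interpretation, $\Delta$ a formula, $\tau$ a finite sequence of formulas). Initial state: $\mathcal{I}_0=\textsc{Solve}(\phi)$, $\Delta_0=\textsc{Better}(\mathcal{I}_0)$, $\tau_0=(\Delta_0)$. Rules (unmentioned components unchanged): F-Split: if $\tau\neq\emptyset$, $\psi=\textsc{Top}(\tau)$, $\phi\models\psi\Leftrightarrow\bigvee_{j=1}^k\psi_j$ with $k\ge1$, then $\tau:=(\psi_1,\dots,\psi_k)\circ\textsc{Pop}(\tau)$. F-Sat: if $\tau\neq\emptyset$, $\psi=\textsc{Top}(\tau)$, $\textsc{Solve}(\phi\wedge\psi)=\mathcal{I}'\neq\bot$, $\Delta'=\Delta\wedge\textsc{Better}(\mathcal{I}')$, then $\mathcal{I}:=\mathcal{I}'$, $\Delta:=\Delta'$, $\tau:=(\Delta')$. F-Close: if $\tau\neq\emptyset$, $\psi=\textsc{Top}(\tau)$, $\textsc{Solve}(\phi\wedge\psi)=\bot$, then $\Delta:=\Delta\wedge\neg\psi$, $\tau:=\textsc{Pop}(\tau)$. A rule applies if its premises hold and the resulting state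 differs; a state is saturated if no rule applies. A $\mathcal{GO}$-derivation is a sequence of states starting at the initial state, each obtained from the previous by one rule. A derivation strategy is progressive if it (i) never halts in a non-saturated state and (ii) uses F-Split only finitely many times in any derivation. *)

(* Defs.v *)
From mathcomp Require Import all_boot.

Set Implicit Arguments.
Unset Strict Implicit.
Unset Printing Implicit Defensive.

(** * Many-sorted first-order logic with equality *)

Record signature := Signature {
  sorts : eqType;
  fsym : Type;
  farity : fsym -> nat;
  farg : forall f : fsym, 'I_(farity f) -> sorts;
  fres : fsym -> sorts;
  psym : Type;
  parity : psym -> nat;
  parg : forall p : psym, 'I_(parity p) -> sorts }.

Section Logic.

(* [X s] is the set of variables of sort [s]; a sorted variable is an element
   of [{s & X s}].
   [U s] is a universe of potential values of sort [s]. Interpretations may have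
   different domains, but the value of a term in one interpretation has to be
   compared with its value in another one: so the domains of a sort [s] are
   subsets of the common [U s], as they would be subsets of the universe of sets
   in set theory. *)
Variables (Sg : signature) (X : sorts Sg -> eqType) (U : sorts Sg -> Type).

Definition svar := {s : sorts Sg & X s}.

Definition infinite_vars : Prop :=
  forall l : seq svar, exists z : svar, z \notin l.

Inductive term : sorts Sg -> Type :=
| TVar (s : sorts Sg) (x : X s) : term s
| TApp (f : fsym Sg) (a : forall i : 'I_(farity f), term (farg i)) :
    term (fres f).

Inductive formula : Type :=
| FTrue
| FFalse
| FPred (p : psym Sg) (a : forall i : 'I_(parity p), term (parg i))
| FEq (s : sorts Sg) (t1 t2 : term s)
| FNot (f : formula)
| FAnd (f g : formula)
| FOr (f g : formula)
| FImp (f g : formula)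
| FIff (f g : formula)
| FAll (s : sorts Sg) (x : X s) (f : formula)
| FEx (s : sorts Sg) (x : X s) (f : formula).

Definition FDisj (fs : seq formula) : formula := foldr FOr FFalse fs.

Fixpoint tfree (z : svar) (s : sorts Sg) (t : term s) : Prop :=
  match t with
  | TVar _ x => z = Tagged X x
  | TApp _ a => exists i, tfree z (a i)
  end.

Fixpoint free (z : svar) (f : formula) : Prop :=
  match f with
  | FTrue | FFalse => False
  | FPred _ a => exists i, tfree z (a i)
  | FEq _ t1 t2 => tfree z t1 \/ tfree z t2
  | FNot g => free z g
  | FAnd g h | FOr g h | FImp g h | FIff g h => free z g \/ free z h
  | FAll _ x g | FEx _ x g => z <> Tagged X x /\ free z g
  end.

Record structure := Structure {
  dom : forall s, U s -> Prop;
  dom_inhabited : forall s, exists u, @dom s u;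
  ifun : forall f : fsym Sg,
    (forall i : 'I_(farity f), {u | @dom (farg i) u}) -> {u | @dom (fres f) u};
  ipred : forall p : psym Sg,
    (forall i : 'I_(parity p), {u | @dom (parg i) u}) -> Prop }.

Definition carrier (M : structure) (s : sorts Sg) : Type := {u | @dom M s u}.

Definition valuation (M : structure) : Type :=
  forall z : svar, carrier M (tag z).

Definition assign (M : structure) (v : valuation M) (s : sorts Sg) (x : X s)
    (a : carrier M s) : valuation M :=
  @dfwith svar (fun z => carrier M (tag z)) v (Tagged X x) a.

Fixpoint eval (M : structure) (v : valuation M) (s : sorts Sg) (t : term s) :
    carrier M s :=
  match t in term s0 return carrier M s0 with
  | TVar _ x => v (Tagged X x)
  | TApp _ a => ifun (fun i => eval v (a i))
  end.

(* Equality compares the underlying values, not the membership proofs. *)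
Fixpoint holds (M : structure) (v : valuation M) (f : formula) : Prop :=
  match f with
  | FTrue => True
  | FFalse => False
  | FPred _ a => ipred (fun i => eval v (a i))
  | FEq _ t1 t2 => sval (eval v t1) = sval (eval v t2)
  | FNot g => ~ holds v g
  | FAnd g h => holds v g /\ holds v h
  | FOr g h => holds v g \/ holds v h
  | FImp g h => holds v g -> holds v h
  | FIff g h => holds v g <-> holds v h
  | FAll s x g => forall a : carrier M s, holds (assign v x a) g
  | FEx s x g => exists a : carrier M s, holds (assign v x a) g
  end.

Record interp := Interp {
  istr : structure;
  ival : valuation istr }.

Definition sat (I : interp) (f : formula) : Prop := holds (ival I) f.

Definition tval (s : sorts Sg) (t : term s) (I : interp) : U s :=
  sval (eval (ival I) t).

(* The class of the T-interpretations. *)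
Definition theory := interp -> Prop.

Variable T : theory.

Definition satisfiable (f : formula) : Prop := exists I, T I /\ sat I f.

Definition entails (f g : formula) : Prop :=
  forall I, T I -> sat I f -> sat I g.

Definition value_of_sort (s : sorts Sg) (u : U s) : Prop :=
  exists I, T I /\ dom (istr I) u.

Definition strict_partial_order (s : sorts Sg) (R : U s -> U s -> Prop) : Prop :=
  (forall a, value_of_sort a -> ~ R a a) /\
  (forall a b c, value_of_sort a -> value_of_sort b -> value_of_sort c ->
     R a b -> R b c -> R a c).

Definition definable (s : sorts Sg) (R : U s -> U s -> Prop) : Prop :=
  exists (x y : X s) (f : formula),
    [/\ x <> y,
        forall z, free z f -> z = Tagged X x \/ z = Tagged X y &
        forall I, T I -> forall a b : carrier (istr I) s,
          R (sval a) (sval b) <-> holds (assign (assign (ival I) x a) y b) f].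

(** * Generalized optimization modulo theories *)

Record gomt := Gomt {
  osort : sorts Sg;
  obj : term osort;
  prec : U osort -> U osort -> Prop;
  constr : formula;
  prec_order : strict_partial_order prec;
  prec_definable : definable prec }.

Variable GO : gomt.

Definition consistent (I : interp) : Prop := T I /\ sat I (constr GO).

Definition better_than (I J : interp) : Prop :=
  [/\ consistent I, consistent J & prec (tval (obj GO) I) (tval (obj GO) J)].

Definition optimal (I : interp) : Prop :=
  consistent I /\ ~ exists J, better_than J I.

Definition objective_value (u : U (osort GO)) : Prop :=
  exists I, consistent I /\ tval (obj GO) I = u.

Definition prec_wf : Prop :=
  well_founded (fun a b : {u | objective_value u} => prec (sval a) (sval b)).

(* [None] stands for the answer "unsatisfiable". *)
Definition is_solve (solve : formula -> option interp) : Prop :=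
  forall f,
    (satisfiable f -> exists I, [/\ solve f = Some I, T I & sat I f]) /\
    (~ satisfiable f -> solve f = None).

Definition is_better (better : interp -> formula) : Prop :=
  forall I, consistent I -> forall J, consistent J ->
    (sat J (better I) <-> better_than J I).

(** * The calculus *)

Variables (solve : formula -> option interp) (better : interp -> formula).

Record state := State {
  st_int : interp;
  st_delta : formula;
  st_tau : seq formula }.

Variant initial : state -> Prop :=
| Initial I0 of solve (constr GO) = Some I0 :
    initial (State I0 (better I0) [:: better I0]).

Variant F_Split : state -> state -> Prop :=
| FSplit I D psi tau psis of
    psis <> [::] & entails (constr GO) (FIff psi (FDisj psis)) :
    F_Split (State I D (psi :: tau)) (State I D (psis ++ tau)).

Variant F_Sat : state -> state -> Prop :=
| FSat I D psi tau I' of solve (FAnd (constr GO) psi) = Some I' :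
    F_Sat (State I D (psi :: tau))
          (State I' (FAnd D (better I')) [:: FAnd D (better I')]).

Variant F_Close : state -> state -> Prop :=
| FClose I D psi tau of solve (FAnd (constr GO) psi) = None :
    F_Close (State I D (psi :: tau)) (State I (FAnd D (FNot psi)) tau).

Definition step (q q' : state) : Prop :=
  [\/ F_Split q q', F_Sat q q' | F_Close q q'] /\ q' <> q.

Definition saturated (q : state) : Prop := ~ exists q', step q q'.

(* A finite or infinite sequence of states: [d n] is the [n]-th state, and
   [None] when the sequence has at most [n] states. *)
Definition state_seq := nat -> option state.

Definition derivation (d : state_seq) : Prop :=
  (exists q0, d 0 = Some q0 /\ initial q0) /\
  forall n, match d n, d n.+1 with
            | Some q, Some q' => step q q'
            | None, Some _ => False
            | _, None => True
            end.

Definition history (d : state_seq) (n : nat) : seq state :=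
  pmap d (iota 0 n.+1).

(* A possibly nondeterministic, history-dependent strategy: given the states
   visited so far, the current one being the last, [smove h (Some q)] means that
   it may go on with [q], and [smove h None] that it may halt. *)
Record strategy := Strategy {
  smove : seq state -> option state -> Prop;
  smove_step : forall h q q', smove (rcons h q) (Some q') -> step q q';
  smove_total : forall h, exists m, smove h m }.

Definition generated (st : strategy) (d : state_seq) : Prop :=
  derivation d /\
  forall n q, d n = Some q -> smove st (history d n) (d n.+1).

(* The rule of a step can be read off its two states: F_Split keeps the second
   component of the state, F_Sat and F_Close change it. *)
Definition uses_split (d : state_seq) (n : nat) : Prop :=
  exists q q', [/\ d n = Some q, d n.+1 = Some q' & F_Split q q'].

Definition progressive (st : strategy) : Prop :=
  forall d, generated st d ->
    (forall n q, d n = Some q -> d n.+1 = None -> saturated q) /\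
    (exists N, forall n, uses_split d n -> n < N).

Definition ends_with (d : state_seq) (q : state) : Prop :=
  exists n, d n = Some q /\ d n.+1 = None.

End Logic.

(* Main.v *)
Require Import Defs.
From mathcomp Require Import all_boot.
From Stdlib Require Import Classical.

Set Implicit Arguments.
Unset Strict Implicit.
Unset Printing Implicit Defensive.

(** In every reachable state, among the consistent interpretations, both
    [Delta] and the disjunction of [tau] describe exactly those that are better
    than the current one. Hence F-Sat strictly improves the current
    interpretation, whereas F-Close keeps it and shortens [tau]: without F-Split
    the pair (objective value, length of [tau]) decreases lexicographically, so a
    derivation with finitely many splits is finite. As long as [tau] is nonempty
    F-Sat or F-Close applies, so in a saturated state [tau] is empty and nothing
    is better than the current interpretation. *)

Section Calculus.

Variables (Sg : signature) (X : sorts Sg -> eqType) (U : sorts Sg -> Type).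
Variables (T : theory X U) (GO : gomt T).
Variables (solve : formula X -> option (interp X U)).
Variables (better : interp X U -> formula X).
Hypotheses (hsolve : is_solve T solve) (hbetter : is_better GO better).

Implicit Types (I J : interp X U) (f : formula X) (q : state X U).
Implicit Types (d : state_seq X U).

Lemma solve_some f I : solve f = Some I -> T I /\ sat I f.
Proof.
have [sat_solve unsat_solve] := hsolve f; move=> solve_f.
(* Excluded middle is needed because [is_solve] fixes the answer by two separate implications, on
   satisfiable and on unsatisfiable formulas. *)
case: (classic (satisfiable T f)) => [/sat_solve [J [] ]|/unsat_solve].
  by rewrite solve_f => -[->].
by rewrite solve_f.
Qed.

Lemma solve_none f : solve f = None -> ~ satisfiable T f.
Proof. by move=> solve_f /(hsolve f).1 [I []]; rewrite solve_f. Qed.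

Lemma sat_FDisj_cat I (fs gs : seq (formula X)) :
  sat I (FDisj (fs ++ gs)) <-> sat I (FDisj fs) \/ sat I (FDisj gs).
Proof.
elim: fs => [|f fs IHfs]; first by split=> [|[]] //; right.
have E hs : sat I (FDisj (f :: hs)) <-> sat I f \/ sat I (FDisj hs) by [].
by rewrite cat_cons !E; tauto.
Qed.

Lemma value_of_sort_tval I (s : sorts Sg) (t : term X s) :
  T I -> value_of_sort T (Defs.tval t I).
Proof.
by move=> TI; exists I; split=> //; exact: (svalP (eval (ival I) t)).
Qed.

Lemma consistent_objective_value I :
  consistent GO I -> objective_value (Defs.tval (obj GO) I).
Proof. by exists I. Qed.

Lemma better_than_irr I : ~ better_than GO I I.
Proof.
by case=> [[TI _] _]; apply: (prec_order GO).1 (value_of_sort_tval _ TI).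
Qed.

Lemma better_than_trans I J K :
  better_than GO I J -> better_than GO J K -> better_than GO I K.
Proof.
case=> cI cJ IJ [_ cK JK]; split=> //.
by apply: (prec_order GO).2 IJ JK; apply: value_of_sort_tval;
   [case: cI | case: cJ | case: cK].
Qed.

(** Restricted to consistent [J], since both [better] and the equivalence in F-Split are only
    meaningful under the constraint. *)
Definition describes_better f I : Prop :=
  forall J, consistent GO J -> (sat J f <-> better_than GO J I).

(** The clause on [st_delta] is what survives an F-Sat step, which discards [st_tau] and rebuilds it
    from [st_delta]. *)
Definition state_inv q : Prop :=
  [/\ consistent GO (st_int q),
      describes_better (st_delta q) (st_int q) &
      describes_better (FDisj (st_tau q)) (st_int q)].

Lemma describes_better_FDisj1 f I :
  describes_better f I -> describes_better (FDisj [:: f]) I.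
Proof.
move=> fI J cJ; rewrite -(fI J cJ).
by split=> [[]|] //; left.
Qed.

Lemma initial_inv q : initial GO solve better q -> state_inv q.
Proof.
case=> I0 /solve_some cI0; split=> //=; first exact: hbetter.
exact/describes_better_FDisj1/hbetter.
Qed.

Lemma F_Split_inv q q' : F_Split GO q q' -> state_inv q -> state_inv q'.
Proof.
case=> I D psi tau psis _ equiv [/= cI hD htau]; split=> //= J cJ.
have psiE : sat J psi <-> sat J (FDisj psis) by apply: equiv; case: cJ.
by rewrite sat_FDisj_cat -psiE -(htau J cJ).
Qed.

(** The new interpretation satisfies the top of [st_tau], hence the whole disjunction. *)
Lemma F_Sat_better q q' :
  F_Sat GO solve better q q' -> state_inv q ->
  better_than GO (st_int q') (st_int q).
Proof.
case=> I D psi tau I' /solve_some [TI' [phiI' psiI']] [/= cI hD htau].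
by apply/htau => //; left.
Qed.

(** By transitivity, whatever beats [I'] also beats [I], so it satisfies the old conjunct [D] as
    well. *)
Lemma F_Sat_inv q q' :
  F_Sat GO solve better q q' -> state_inv q -> state_inv q'.
Proof.
move=> qq' qinv; move: (F_Sat_better qq' qinv); case: qq' qinv.
move=> I D psi tau I' _ [/= cI hD htau] I'I; have [cI' _ _] := I'I.
have hD' : describes_better (FAnd D (better I')) I'.
  move=> J cJ; have -> : sat J (FAnd D (better I')) <->
    sat J D /\ sat J (better I') by [].
  rewrite (hD J cJ) (hbetter cI' cJ); split=> [[]|JI'] //.
  by split=> //; apply: better_than_trans JI' I'I.
by split=> //=; apply: describes_better_FDisj1.
Qed.

(** No consistent interpretation satisfies [psi], so among these neither dropping the disjunct [psi]
    nor adding its negation changes anything. *)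
Lemma F_Close_inv q q' : F_Close GO solve q q' -> state_inv q -> state_inv q'.
Proof.
case=> I D psi tau /solve_none unsat [/= cI hD htau].
have notpsi J : consistent GO J -> ~ sat J psi.
  by case=> TJ phiJ psiJ; apply: unsat; exists J.
split=> //= J cJ.
  rewrite -(hD J cJ); split=> [[]|DJ] //; split=> //; exact: notpsi.
rewrite -(htau J cJ); split=> [|[/(notpsi J cJ)|]] //; by right.
Qed.

Lemma step_inv q q' : step GO solve better q q' -> state_inv q -> state_inv q'.
Proof.
by case=> -[qq'|qq'|qq'] _; [apply: F_Split_inv qq'|apply: F_Sat_inv qq'|
  apply: F_Close_inv qq'].
Qed.

Lemma saturated_optimal q :
  state_inv q -> saturated GO solve better q -> optimal GO (st_int q).
Proof.
case: q => I D [|psi tau] qinv qsat; have [/= cI hD htau] := qinv.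
  (* The empty disjunction is [FFalse], so a better [J] is contradictory. *)
  by split=> // -[J JI]; have [cJ _ _] := JI; apply/(htau J cJ).
case: qsat; case solveE: (solve (FAnd (constr GO) psi)) => [I'|].
  have qq' := FSat better I D tau solveE.
  exists (State I' (FAnd D (better I')) [:: FAnd D (better I')]).
  split; first by constructor 2.
  (* A step must change the state: otherwise [I'] would be better than itself. *)
  move=> [eqI _ _ _]; have := F_Sat_better qq' qinv; rewrite eqI /=.
  exact: better_than_irr.
exists (State I (FAnd D (FNot psi)) tau).
split; first by constructor 3; apply: FClose.
by move=> [_ /(congr1 size) /= /n_Sn].
Qed.

Lemma derivation_step d n q q' : derivation GO solve better d ->
  d n = Some q -> d n.+1 = Some q' -> step GO solve better q q'.
Proof. by case=> _ /(_ n) + dn dSn; rewrite dn dSn. Qed.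

Lemma derivation_inv d n q :
  derivation GO solve better d -> d n = Some q -> state_inv q.
Proof.
move=> der; elim: n q => [|n IHn] q dn.
  case: der => -[q0 [d0 q0init]] _.
  by move: d0; rewrite dn => -[->]; apply: initial_inv.
case dn' : (d n) => [q1|].
  exact: step_inv (derivation_step der dn' dn) (IHn _ dn').
by case: der => _ /(_ n); rewrite dn' dn.
Qed.

Lemma derivation_finite d N : prec_wf GO -> derivation GO solve better d ->
  (forall n, uses_split GO d n -> n < N) -> exists q, ends_with d q.
Proof.
move=> wf der split_lt.
(* From index [N] on there are no splits. The outer induction is on the objective value, the inner
   one on the length of [st_tau]. *)
have late (a : {u | objective_value (GO := GO) u}) k n q :
    N <= n -> d n = Some q -> Defs.tval (obj GO) (st_int q) = sval a ->
    size (st_tau q) = k -> exists q', ends_with d q'.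
  elim/(well_founded_ind wf): a k n q => a IHa.
  elim/ltn_ind=> k IHk n q leNn dn qa qk.
  case dn' : (d n.+1) => [q'|]; last by exists q, n.
  have [rule _] := derivation_step der dn dn'.
  have qinv := derivation_inv der dn.
  case: rule => qq'.
  - suff /split_lt : uses_split GO d n by rewrite ltnNge leNn.
    by exists q, q'.
  - have [cI' _ q'q] := F_Sat_better qq' qinv.
    (* The value drops, so the new length of [st_tau], possibly larger, is arbitrary here. *)
    apply: (IHa (exist _ _ (consistent_objective_value cI')) _ _ n.+1 q') => //.
      by rewrite /= -qa.
    exact: leqW.
  - case: qq' dn' qa qk => I D psi tau _ dn' /= qa qk.
    by apply: (IHk (size tau) _ n.+1 _ (leqW leNn) dn'); rewrite // -qk.
case dN : (d N) => [q|].
  have [cI _ _] := derivation_inv der dN.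
  exact: (late (exist _ _ (consistent_objective_value cI)) _ N q).
(* The derivation stops before index [N]: descend to its last state, which exists because index 0
   holds the initial one. *)
elim: N dN {split_lt late} => [|n IHn] dn.
  by case: der => -[q0 [d0 _]]; rewrite dn in d0.
by case dn' : (d n) => [q|]; [exists q, n | apply: IHn].
Qed.

End Calculus.

Theorem theorem3 (Sg : signature) (X : sorts Sg -> eqType)
    (U : sorts Sg -> Type) (T : theory X U) (GO : gomt T)
    (solve : formula X -> option (interp X U))
    (better : interp X U -> formula X)
    (hX : infinite_vars X)
    (hsolve : is_solve T solve)
    (hbetter : is_better GO better)
    (hphi : satisfiable T (constr GO))
    (hwf : prec_wf GO)
    (hopt : exists I : interp X U, optimal GO I)
    (st : strategy GO solve better) (hst : progressive st)
    (d : state_seq X U) (hd : generated st d) :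
  exists q : state X U,
    [/\ ends_with d q, saturated GO solve better q & optimal GO (st_int q)].
Proof.
have [halts [N split_lt]] := hst d hd; have [der _] := hd.
have [q [n [dn dSn]]] := derivation_finite hsolve hbetter hwf der split_lt.
have qsat := halts n q dn dSn.
exists q; split=> //; first by exists n.
have qinv := derivation_inv hsolve hbetter der dn.
exact: (saturated_optimal hsolve qinv qsat).
Qed.
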